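(* Let $\mathcal{S}=\langle\mathbf{Fm},\vdash\rangle$ be a Hilbert-style logic with set of axioms $A$ and set of rules of inference $R_\mathcal{S}$, and let $\mathcal{S}^{re}=\langle\mathbf{Fm},\vdash^{re}\rangle$ be its restricted rules companion. Then for every $\varphi\in\mathit{Fm}$, $\vdash^{re}\varphi$ if and only if $\vdash\varphi$.
   Context: $\mathbf{Fm}$ is the formula algebra of some logical language $\mathcal{L}$ (connectives of finite arity) over a countably infinite set $V$ of variables, universe $\mathit{Fm}$. A Hilbert-style logic is given by a set of axioms $A\subseteq\mathit{Fm}$ and a set of rules $R\subseteq\mathcal{P}(\mathit{Fm})\times\mathit{Fm}$ (written $\frac{\Gamma}{\alpha}$), both given schematically, i.e. closed under substitution of formulas for variables; then $\Sigma\vdash\varphi$ iff there is a finite sequence of formulas ending in $\varphi$, each member of which is an axiom (instance), a member of $\Sigma$, or obtained from earlier members $\Gamma$ by a rule $\frac{\Gamma}{\alpha}\in R$. $\vdash\varphi$ means $\emptyset\vdash\varphi$. $\mathrm{var}(\varphi)$ denotes the set of variables in $\varphi$, $\mathrm{var}(\Gamma)=\bigcup_{\gamma\in\Gamma}\mathrm{var}(\gamma)$. The restricted rules companion $\mathcal{S}^{re}$ of the Hilbert-style logic with axioms $A$ and rules $R_\mathcal{S}$ is the Hilbert-style logic with the same axioms $A$ and rules $R_{\mathcal{S}^{re}}=\{\frac{\Gamma}{\alpha}\in R_\mathcal{S}\mid \mathrm{var}(\Gamma)\subseteq\mathrm{var}(\alpha)\}$. *)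

(* Defs.v *)
From mathcomp Require Import all_boot.
From mathcomp Require Import boolp classical_sets functions cardinality.

Set Implicit Arguments.
Unset Strict Implicit.
Unset Printing Implicit Defensive.

Local Open Scope classical_set_scope.

Record language := Language {
  connective : Type;
  arity : connective -> nat }.

(* The arguments of a connective form a finite function, so that formulas are
   the elements of the absolutely free algebra of type [L] generated by [V]. *)
Inductive formula (L : language) (V : Type) : Type :=
| Var of V
| Conn (c : connective L) of {ffun 'I_(arity c) -> formula L V}.
Arguments Var {L V} x.
Arguments Conn {L V} c f.

Section Formulas.
Variables (L : language) (V : Type).
Local Notation Fm := (formula L V).

Lemma formula_induction (P : Fm -> Prop) :
  (forall x, P (Var x)) ->
  (forall c (f : {ffun 'I_(arity c) -> Fm}),
    (forall i, P (f i)) -> P (Conn c f)) ->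
  forall phi, P phi.
Proof.
move=> PV PC; fix IH 1 => -[x|c f]; first exact: PV.
by apply: PC => i; apply: IH.
Qed.

(* The endomorphism of the formula algebra extending [s]. *)
Fixpoint subst (s : V -> Fm) (phi : Fm) : Fm :=
  match phi with
  | Var x => s x
  | Conn c f => Conn c [ffun i => subst s (f i)]
  end.

Fixpoint var (phi : Fm) : set V :=
  match phi with
  | Var x => [set x]
  | Conn c f => \bigcup_i var (f i)
  end.

Definition vars (Gamma : set Fm) : set V := \bigcup_(gamma in Gamma) var gamma.

Lemma var_subst (s : V -> Fm) (phi : Fm) :
  var (subst s phi) = \bigcup_(x in var phi) var (s x).
Proof.
elim/formula_induction: phi => [x|c f IH] /=; first by rewrite bigcup_set1.
apply/seteqP; split=> y.
- by move=> [i _]; rewrite ffunE IH => -[x fx sy]; exists x => //; exists i.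
- by move=> [x [i _ fx] sy]; exists i => //; rewrite ffunE IH; exists x.
Qed.

(* A pair [(Gamma, alpha)] in [rules] is the rule with set of premises [Gamma],
   possibly infinite, and conclusion [alpha]. *)
Record hilbert_logic := HilbertLogic {
  axioms : set Fm;
  rules : set (set Fm * Fm);
  axioms_subst : forall s alpha, axioms alpha -> axioms (subst s alpha);
  rules_subst : forall s Gamma alpha,
    rules (Gamma, alpha) -> rules (subst s @` Gamma, subst s alpha) }.

Definition derives (S : hilbert_logic) (Sigma : set Fm) (phi : Fm) : Prop :=
  exists (n : nat) (d : 'I_n.+1 -> Fm),
    d ord_max = phi /\
    forall i : 'I_n.+1,
      [\/ axioms S (d i),
          Sigma (d i)
        | exists2 Gamma : set Fm,
            rules S (Gamma, d i) & Gamma `<=` d @` [set j : 'I_n.+1 | (j < i)%N]].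

Definition restricted_rules (S : hilbert_logic) : set (set Fm * Fm) :=
  [set r | rules S r /\ vars r.1 `<=` var r.2].

Lemma restricted_rules_subst (S : hilbert_logic) s Gamma alpha :
  restricted_rules S (Gamma, alpha) ->
  restricted_rules S (subst s @` Gamma, subst s alpha).
Proof.
move=> [/= SGa sub]; split=> /=; first exact: rules_subst.
move=> y [_ [gamma Ggamma <-]]; rewrite !var_subst => -[x gx sy].
by exists x => //; apply: sub; exists gamma.
Qed.

Definition restricted_companion (S : hilbert_logic) : hilbert_logic :=
  @HilbertLogic (axioms S) (restricted_rules S)
    (@axioms_subst S) (@restricted_rules_subst S).

End Formulas.

(* Main.v *)
(* Let sigma fix the variables of alpha and send every other variable to alpha
   itself. If Gamma / alpha is a rule, so is sigma Gamma / alpha, and the latter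
   is restricted: sigma gamma has all its variables in alpha. A proof is
   therefore made restricted step by step: before each use of Gamma / alpha,
   insert the sigma-image of everything proved so far. Choosing alpha, rather
   than a variable of alpha, as the target also covers closed alpha. *)
Require Import Defs.
From Stdlib Require List.
From mathcomp Require Import all_boot.
From mathcomp Require Import boolp classical_sets functions cardinality.

Local Open Scope classical_set_scope.

Section RestrictedRules.
Set Implicit Arguments.
Unset Strict Implicit.
Variables (L : language) (V : Type).
Local Notation Fm := (formula L V).
Implicit Types (S : hilbert_logic L V) (Gamma : set Fm) (alpha : Fm).
Implicit Types (l : seq Fm) (s : V -> Fm).

Lemma subst_id_in s alpha :
  (forall x, var alpha x -> s x = Var x) -> subst s alpha = alpha.
Proof.
elim/formula_induction: alpha => [x|c f IH] /= sE; first exact: sE.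
congr Conn; apply/ffunP => i; rewrite ffunE; apply: IH => x fx.
by apply: sE; exists i.
Qed.

Definition absorb alpha (x : V) : Fm :=
  if `[< var alpha x >] then Var x else alpha.

Lemma subst_absorb alpha : subst (absorb alpha) alpha = alpha.
Proof. by apply: subst_id_in => x ax; rewrite /absorb asboolT. Qed.

Lemma var_subst_absorb alpha (gamma : Fm) :
  var (subst (absorb alpha) gamma) `<=` var alpha.
Proof.
rewrite var_subst => y [x _]; rewrite /absorb.
by case: asboolP => [ax /= ->|].
Qed.

Lemma absorb_restricted_rule S Gamma alpha : rules S (Gamma, alpha) ->
  restricted_rules S (subst (absorb alpha) @` Gamma, alpha).
Proof.
move=> SGa; split=> /=.
  (* Only the conclusion is rewritten, as its own image under [absorb alpha], so that closure of
     [rules] under substitution applies. *)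
  by rewrite -[X in (_, X)]subst_absorb; exact: rules_subst.
by move=> y [_ [gamma _ <-]]; exact: var_subst_absorb.
Qed.

(* Proofs without hypotheses, the most recent formula coming first. *)
Inductive proof S : seq Fm -> Prop :=
| proof_nil : proof S [::]
| proof_axiom alpha l : axioms S alpha -> proof S l -> proof S (alpha :: l)
| proof_rule Gamma alpha l : rules S (Gamma, alpha) ->
    Gamma `<=` [set gamma | List.In gamma l] -> proof S l ->
    proof S (alpha :: l).

Lemma proof_cat S l1 l2 : proof S l1 -> proof S l2 -> proof S (l1 ++ l2).
Proof.
move=> p1 p2; elim: p1 => //= [alpha l Aa _ IH|Gamma alpha l SGa Gl _ IH].
  exact: proof_axiom.
apply: proof_rule SGa _ IH => gamma /Gl lgamma.
by apply/List.in_app_iff; left.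
Qed.

(** Axioms and rules are closed under substitution; for the restricted companion this rests on
    [restricted_rules_subst]. *)
Lemma proof_map_subst S s l : proof S l -> proof S (map (subst s) l).
Proof.
elim=> /= [|alpha {}l Aa _ IH|Gamma alpha {}l SGa Gl _ IH].
- exact: proof_nil.
- by apply: proof_axiom IH; exact: axioms_subst.
- apply: proof_rule IH; first exact: rules_subst SGa.
  by move=> _ [gamma /Gl lgamma <-]; exact: List.in_map.
Qed.

Lemma In_nth (T : Type) (x0 x : T) (r : seq T) :
  List.In x r -> exists2 i, (i < size r)%N & nth x0 r i = x.
Proof.
elim: r => //= y r IH [->|/IH[i ir <-]]; first by exists 0.
by exists i.+1.
Qed.

(** Passage from lists to the indexed form used by [derives]: the newest formula stands first, so
    premises lie at larger indices. *)
Lemma proof_nth S l (x0 : Fm) i : proof S l -> (i < size l)%N ->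
  axioms S (nth x0 l i) \/
  exists2 Gamma, rules S (Gamma, nth x0 l i) &
    Gamma `<=` nth x0 l @` [set j | (i < j < size l)%N].
Proof.
move=> pl.
elim: pl i => //= [alpha {}l Aa _ IH|Gamma alpha {}l SGa Gl _ IH] [|i] /=.
- by left.
- move=> /IH[|[G SG Gn]]; [by left|right; exists G => // g /Gn[j ij <-]].
  by exists j.+1.
- move=> _; right; exists Gamma => // gamma /Gl /(In_nth x0)[j jl <-].
  by exists j.+1.
- move=> /IH[|[G SG Gn]]; [by left|right; exists G => // g /Gn[j ij <-]].
  by exists j.+1.
Qed.

Lemma proof_derives S alpha l : proof S (alpha :: l) -> derives S set0 alpha.
Proof.
(* The list is read backwards, which puts its head [alpha] at the last index [size l]; the default
   of [nth] is never reached. *)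
move=> pl; exists (size l), (fun i => nth alpha (alpha :: l) (size l - i)).
split=> [|i]; first by rewrite /= subnn.
have il : (size l - i < size (alpha :: l))%N by rewrite ltnS leq_subr.
case: (proof_nth alpha pl il) => [|[G SG Gn]]; first by constructor 1.
constructor 3; exists G => // g /Gn[j /andP[ij jl] <-].
have jl' : (size l - j < (size l).+1)%N by rewrite ltnS leq_subr.
exists (Ordinal jl') => /=; last by rewrite subKn.
by rewrite ltn_subCl // -ltnS.
Qed.

(** The part of the list from an occurrence of [alpha] onwards is itself a proof, with [alpha] as
    its newest formula. *)
Lemma proof_in_derives S alpha l :
  proof S l -> List.In alpha l -> derives S set0 alpha.
Proof.
elim=> //= [beta {}l Ab pl IH|Gamma beta {}l SGb Gl pl IH] [<-|/IH //].
- by apply: (proof_derives (l := l)); exact: proof_axiom.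
- by apply: (proof_derives (l := l)); exact: proof_rule SGb Gl pl.
Qed.

(** The image of [l] supplies the premises of the restricted rule; [l] itself is kept because later
    rules may need its formulas unsubstituted. *)
Lemma restricted_rule_step S Gamma alpha l : rules S (Gamma, alpha) ->
  Gamma `<=` [set gamma | List.In gamma l] ->
  proof (restricted_companion S) l ->
  proof (restricted_companion S) (alpha :: map (subst (absorb alpha)) l ++ l).
Proof.
move=> SGa Gl pl.
apply: (@proof_rule (restricted_companion S) (subst (absorb alpha) @` Gamma)).
- exact: absorb_restricted_rule.
- move=> _ [gamma /Gl lgamma <-].
  by apply/List.in_app_iff; left; exact: List.in_map.
- by apply: proof_cat => //; exact: proof_map_subst.
Qed.

Lemma derives_restricted S alpha :
  derives S set0 alpha -> derives (restricted_companion S) set0 alpha.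
Proof.
move=> [n [d [<- dP]]].
(* The inserted images lengthen the proof, so the invariant only asks that the first [k] formulas of
   [d] occur somewhere in one restricted proof. *)
suff /(_ n.+1 (leqnn _)) [l pl dl] : forall k, (k <= n.+1)%N ->
    exists2 l, proof (restricted_companion S) l &
      forall j : 'I_n.+1, (j < k)%N -> List.In (d j) l.
  by apply: proof_in_derives pl _; exact: dl.
elim=> [_|k IH kn]; first by exists [::] => //; exact: proof_nil.
have [l pl dl] := IH (ltnW kn); pose i := Ordinal kn.
have jP (j : 'I_n.+1) : (j < k.+1)%N -> j = i \/ (j < k)%N.
  by rewrite ltnS leq_eqVlt => /predU1P[jk|]; [left; exact: val_inj|right].
(* The case of a hypothesis is void, since the set of hypotheses is [set0]. *)
case: (dP i) => [Ad|//|[Gamma SG Gd]].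
- exists (d i :: l); first exact: proof_axiom.
  by move=> j /jP[->|/dl]; [left|right].
- exists (d i :: map (subst (absorb (d i))) l ++ l).
    by apply: restricted_rule_step SG _ pl => _ /Gd[j ji <-]; exact: dl.
  move=> j /jP[->|/dl dj]; first by left.
  by right; apply/List.in_app_iff; right.
Qed.

Lemma restricted_derives S (Sigma : set Fm) alpha :
  derives (restricted_companion S) Sigma alpha -> derives S Sigma alpha.
Proof.
move=> [n [d [dn dP]]]; exists n, d; split=> // i.
case: (dP i) => [Ad|Sd|[Gamma [SG _] Gd]].
- by constructor 1.
- by constructor 2.
- by constructor 3; exists Gamma.
Qed.

End RestrictedRules.

Theorem theorem3p4 (L : language) (V : Type)
    (V_countable : countable [set: V]) (V_infinite : infinite_set [set: V])
    (S : hilbert_logic L V) (phi : formula L V) :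
  derives (restricted_companion S) set0 phi <-> derives S set0 phi.
Proof. by split; [exact: restricted_derives|exact: derives_restricted]. Qed.
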